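(* Let $p\in(\tfrac14,\tfrac13]$. Let $\mathcal D=\bigcup_{\mathbf s\in\mathds S}\mathcal C(\mathbf s)$ be the union of all generalised $p$-Koch curves and let $\mathcal{DF}=\bigcup_{\mathbf s,\mathbf t,\mathbf r\in\mathds S}\mathcal F(\mathbf s,\mathbf t,\mathbf r)$ be the union of all generalised $p$-Koch snowflakes. Then $$\dim_{\mathcal H}(\mathcal{DF})=\dim_{\mathcal H}(\mathcal D)=\frac{\log(6)}{\log(p^{-1})}<2.$$ Moreover, $\mathcal{DF}$ does not contain any non-empty open subset of $\mathbb R^2$, and $\mathcal{DF}$ has zero two-dimensional Lebesgue measure.
   Context: Notation: $\mathbb N=\{1,2,\dots\}$, $\mathbb N_0=\mathbb N\cup\{0\}$, $p\in(\tfrac14,\tfrac13]$, $q=\sqrt{4p-1}$; $\dim_{\mathcal H}$ is Hausdorff dimension. $V\subset\mathbb R^2$ is the closed filled-in rhombus (closed convex hull) with vertices $P_\pm=(\pm\tfrac12,0)$ and $Q_\pm=(0,\pm\tfrac12 q)$. Maps: for $(a,b)\in A=\{0,1,2,3\}\times\{0,1\}$ the affine maps $\phi_{(a,b)}$ (which map $V$ into $V$) are $\phi_{(0,0)}(x,y)=\phi_{(0,1)}(x,y)=(px-\tfrac{1-p}{2},\,py)$; $\phi_{(3,0)}(x,y)=\phi_{(3,1)}(x,y)=(px+\tfrac{1-p}{2},\,py)$; $\phi_{(1,0)}(x,y)=\big(\tfrac12((1-2p)x-qy)+\tfrac{2p-1}{4},\ \tfrac12(qx+(1-2p)y)+\tfrac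 q4\big)$; $\phi_{(2,0)}(x,y)=\big(\tfrac12((1-2p)x+qy)+\tfrac{1-2p}{4},\ \tfrac12(-qx+(1-2p)y)+\tfrac q4\big)$; $\phi_{(1,1)}(x,y)=\big(\tfrac12((1-2p)x+qy)+\tfrac{2p-1}{4},\ \tfrac12(-qx+(1-2p)y)-\tfrac q4\big)$; $\phi_{(2,1)}(x,y)=\big(\tfrac12((1-2p)x-qy)+\tfrac{1-2p}{4},\ \tfrac12(qx+(1-2p)y)-\tfrac q4\big)$. Generalised $p$-Koch curves: an element $\mathbf s\in\mathds S=\prod_{k=0}^\infty\{0,1\}^{4^k}$ is written $\mathbf s=((s_k(0),s_k(1),\dots,s_k(4^k-1)))_{k=0}^\infty$ with $s_k(i)\in\{0,1\}$. For $\mathbf u=(u_k)_{k\in\mathbb N}\in\{0,1,2,3\}^{\mathbb N}$ put $\omega_1(\mathbf u,\mathbf s)=(u_1,s_0(0))$ and, for $k\ge2$, $\omega_k(\mathbf u,\mathbf s)=\big(u_k,\,s_{k-1}(\sum_{j=1}^{k-1}u_j4^{k-1-j})\big)\in A$. Let $\Sigma(\mathbf s)=\{(\omega_k(\mathbf u,\mathbf s))_{k\in\mathbb N}:\mathbf u\in\{0,1,2,3\}^{\mathbb N}\}$ and $$\mathcal C(\mathbf s)=\bigcup_{(\omega_k)_{k\in\mathbb N}\in\Sigma(\mathbf s)}\ \bigcap_{k\in\mathbb N}(\phi_{\omega_1}\circ\cdots\circ\phi_{\omega_k})(V).$$ Generalised $p$-Koch snowflakes: let $f_1(x,y)=\big(-\tfrac12x+\tfrac{\sqrt3}{2}y+\tfrac14,\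 -\tfrac{\sqrt3}{2}x-\tfrac12y-\tfrac{\sqrt3}{4}\big)$ and $f_2(x,y)=\big(-\tfrac12x-\tfrac{\sqrt3}{2}y-\tfrac14,\ \tfrac{\sqrt3}{2}x-\tfrac12y-\tfrac{\sqrt3}{4}\big)$. For $\mathbf s,\mathbf t,\mathbf r\in\mathds S$, $\mathcal F(\mathbf s,\mathbf t,\mathbf r)=\mathcal C(\mathbf s)\cup f_1(\mathcal C(\mathbf t))\cup f_2(\mathcal C(\mathbf r))$. *)

(* Defs.v *)
From HB Require Import structures.
From mathcomp Require Import all_boot all_order all_algebra.
From mathcomp Require Import all_classical all_reals all_analysis.

Set Implicit Arguments.
Unset Strict Implicit.
Unset Printing Implicit Defensive.
Import Order.TTheory GRing.Theory Num.Theory.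
Import numFieldNormedType.Exports.
Local Open Scope classical_set_scope.
Local Open Scope ring_scope.

Section Hausdorff.
Variable R : realType.

(* The norm that the library puts on R * R is the sup norm. *)
Definition euclidean_dist (u v : R * R) : R :=
  Num.sqrt ((u.1 - v.1) ^+ 2 + (u.2 - v.2) ^+ 2).

(* This is -oo when U is empty. *)
Definition diam (U : set (R * R)) : \bar R :=
  ereal_sup [set (euclidean_dist u v)%:E | u in U & v in U].

(* The empty set has gauge 0 and, since 0 `^ 0 = 1, a singleton has gauge 1
   for s = 0, so that the 0-dimensional measure counts points. *)
Definition hausdorff_gauge (s : R) (U : set (R * R)) : \bar R :=
  if U == set0 then 0%E else (diam U `^ s)%E.

Definition hausdorff_premeasure (s delta : R) (E : set (R * R)) : \bar R :=
  ereal_inf [set (\sum_(0 <= i <oo) hausdorff_gauge s (U i))%E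
    | U in [set U : nat -> set (R * R) |
        E `<=` \bigcup_i U i /\ forall i, (diam (U i) <= delta%:E)%E]].

(* The premeasure is nonincreasing in delta: the supremum is the limit as
   delta tends to 0. *)
Definition hausdorff_measure (s : R) (E : set (R * R)) : \bar R :=
  ereal_sup [set hausdorff_premeasure s delta E | delta in [set d | 0 < d]].

Definition hausdorff_dim (E : set (R * R)) : \bar R :=
  ereal_inf [set s%:E | s in [set s | 0 <= s /\ hausdorff_measure s E = 0%E]].

End Hausdorff.

Section Koch.
Variables (R : realType) (p : R).

Let q : R := Num.sqrt (4 * p - 1).

Definition closed_convex_hull (E : set (R * R)) : set (R * R) :=
  \bigcap_(K in [set K : set (R * R) |
    [/\ closed K, @convex_set R (R^o * R^o)%type K & E `<=` K]]) K.

Definition rhombus : set (R * R) :=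
  closed_convex_hull
    [set (1 / 2, 0); (- (1 / 2), 0); (0, q / 2); (0, - (q / 2))].

(* In a pair (a, b), false stands for b = 0 and true for b = 1. *)
Definition phi (w : 'I_4 * bool) (v : R * R) : R * R :=
  let x := v.1 in let y := v.2 in
  match nat_of_ord w.1, w.2 with
  | 0%N, _ => (p * x - (1 - p) / 2, p * y)
  | 1%N, false => (((1 - 2 * p) * x - q * y) / 2 + (2 * p - 1) / 4,
                 (q * x + (1 - 2 * p) * y) / 2 + q / 4)
  | 2%N, false => (((1 - 2 * p) * x + q * y) / 2 + (1 - 2 * p) / 4,
                 (- q * x + (1 - 2 * p) * y) / 2 + q / 4)
  | 1%N, true => (((1 - 2 * p) * x + q * y) / 2 + (2 * p - 1) / 4,
                (- q * x + (1 - 2 * p) * y) / 2 - q / 4)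
  | 2%N, true => (((1 - 2 * p) * x - q * y) / 2 + (1 - 2 * p) / 4,
                (q * x + (1 - 2 * p) * y) / 2 - q / 4)
  | _, _ => (p * x + (1 - p) / 2, p * y)
  end.

Fixpoint phi_comp (w : nat -> 'I_4 * bool) (k : nat) : R * R -> R * R :=
  if k is k'.+1 then phi_comp w k' \o phi (w k') else id.

End Koch.

Definition sign_tree : Type := forall k : nat, {ffun 'I_(4 ^ k) -> bool}.

(* Sequences indexed by {1, 2, ...} are shifted to start at index 0: u k and
   omega u s k below are u_{k+1} and omega_{k+1}(u, s). *)
Definition address (u : nat -> 'I_4) (k : nat) : nat :=
  (\sum_(j < k) u j * 4 ^ (k - 1 - j))%N.

Lemma address_lt (u : nat -> 'I_4) (k : nat) : (address u k < 4 ^ k)%N.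
Proof.
rewrite /address; elim: k => [|k IH]; first by rewrite big_ord0.
rewrite big_ord_recr /= subn1 subnn muln1.
have -> : (\sum_(i < k) u i * 4 ^ (k - i) =
           4 * \sum_(i < k) u i * 4 ^ (k - 1 - i))%N.
  rewrite big_distrr /=; apply: eq_bigr => i _.
  by rewrite mulnCA -expnS -subSn ?subn1 ?prednK ?(leq_ltn_trans _ (ltn_ord i)) //
    -ltnS prednK ?(leq_ltn_trans _ (ltn_ord i)).
rewrite expnS; set A := (\sum_(i < k) _)%N in IH *.
apply: (@leq_trans (4 * A.+1)%N); last by rewrite leq_mul2l.
by rewrite mulnS addnC ltn_add2r ltn_ord.
Qed.

Definition omega (u : nat -> 'I_4) (s : sign_tree) (k : nat) : 'I_4 * bool :=
  (u k, s k (Ordinal (address_lt u k))).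

Definition Sigma (s : sign_tree) : set (nat -> 'I_4 * bool) :=
  [set omega u s | u in [set: nat -> 'I_4]].

Section CurvesAndSnowflakes.
Variables (R : realType) (p : R).

(* The intersection starts at words of length 1. *)
Definition koch_curve (s : sign_tree) : set (R * R) :=
  \bigcup_(w in Sigma s) \bigcap_k (phi_comp p w k.+1 @` rhombus p).

Definition snowflake_f1 (v : R * R) : R * R :=
  (- (1 / 2) * v.1 + Num.sqrt 3 / 2 * v.2 + 1 / 4,
   - (Num.sqrt 3 / 2) * v.1 - 1 / 2 * v.2 - Num.sqrt 3 / 4).

Definition snowflake_f2 (v : R * R) : R * R :=
  (- (1 / 2) * v.1 - Num.sqrt 3 / 2 * v.2 - 1 / 4,
   Num.sqrt 3 / 2 * v.1 - 1 / 2 * v.2 - Num.sqrt 3 / 4).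

Definition koch_snowflake (s t r : sign_tree) : set (R * R) :=
  koch_curve s `|` snowflake_f1 @` koch_curve t
               `|` snowflake_f2 @` koch_curve r.

Definition all_koch_curves : set (R * R) :=
  \bigcup_(s in [set: sign_tree]) koch_curve s.

Definition all_koch_snowflakes : set (R * R) :=
  [set x | exists s t r : sign_tree, koch_snowflake s t r x].

End CurvesAndSnowflakes.

(* Main.v *)
Require Import Defs.
From HB Require Import structures.
From mathcomp Require Import all_boot all_order all_algebra.
From mathcomp Require Import all_classical all_reals all_analysis.
From mathcomp Require Import ring lra zify.
Import Order.TTheory GRing.Theory Num.Theory.
Import numFieldNormedType.Exports.
Local Open Scope classical_set_scope.
Local Open Scope ring_scope.

(** Two letters of the alphabet label the same map when they are (0, 0) and
(0, 1), or (3, 0) and (3, 1), so only six maps occur, and all six are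
similarities of ratio p.  Every sequence of letters belongs to Sigma(s) for a
suitable tree s ([Sigma_exists]), so the union of all curves is the full
self-similar set D of this six-map system, and the union of all snowflakes
consists of D and two isometric copies of D.  The similarity dimension of six
maps of ratio p is the number d = ln 6 / ln (1/p), which is less than 2 because
6 < 9 <= p^-2.

Upper bounds.  At level m the snowflakes are covered by 3 * 6^m sets of
diameter at most 2 p^m.  For s > d the numbers 6^m p^(m s) tend to 0, so the
s-dimensional measure vanishes ([hausdorff_measure_snowflakes]).  Enclosing
each set in a square gives area O((6 p^2)^m), which tends to 0, so the set is
Lebesgue null ([negligible_snowflakes]); a null set contains no ball.

Lower bound.  The open set condition holds for the interior of the rhombus V,
in a quantitative form.  The function [depth] measures how far a point is
inside V.  The six maps shrink it by a factor at least p ([depth_phi_letter]),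
and the six image rhombi lie in regions bounded by horizontal and vertical
lines, at a distance from these lines controlled by the depth
([zone_phi_letter]).  This is where p <= 1/3 enters.  Hence distinct tiles of
level m have centres at distance at least a constant times p^m
([tile_separated]), and a set of diameter at most p^m meets a bounded number
M of tiles of level m ([card_meets]).

The mass distribution is Lebesgue outer measure on [0, 1), read through base 6:
the digits of x spell the address of a point of D ([coding_point]).  The set of
x whose point lies in a set U of diameter at most p^m is covered by M intervals
of length 6^-m, and 6^-m = p^(m d), so for s < d its outer measure is at most a
constant times (diam U)^s ([lambda_pullback_gauge]).  Countable subadditivity
bounds the gauge sum of every cover of D from below by a positive constant.  The
measure has to be an outer measure because the covering sets are arbitrary. *)

Set Implicit Arguments.
Unset Strict Implicit.
Unset Printing Implicit Defensive.

(** * Euclidean distance *)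

Section EuclideanDistance.
Variable R : realType.
Implicit Types u v : R * R.

Lemma euclidean_dist_ge0 u v : 0 <= euclidean_dist u v.
Proof. exact: sqrtr_ge0. Qed.

Lemma le_euclidean_dist1 u v : `|u.1 - v.1| <= euclidean_dist u v.
Proof. by rewrite -sqrtr_sqr ler_wsqrtr// lerDl sqr_ge0. Qed.

Lemma le_euclidean_dist2 u v : `|u.2 - v.2| <= euclidean_dist u v.
Proof. by rewrite -sqrtr_sqr ler_wsqrtr// lerDr sqr_ge0. Qed.

Lemma euclidean_dist_le u v :
  euclidean_dist u v <= `|u.1 - v.1| + `|u.2 - v.2|.
Proof.
rewrite -(ler_pXn2r (_ : 0 < 2)%N) ?nnegrE ?addr_ge0 ?euclidean_dist_ge0//.
rewrite sqr_sqrtr ?addr_ge0 ?sqr_ge0// -(real_normK (num_real (u.1 - v.1))).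
rewrite -(real_normK (num_real (u.2 - v.2))).
by have := normr_ge0 (u.1 - v.1); have := normr_ge0 (u.2 - v.2); nra.
Qed.

Lemma euclidean_dist_scale (c : R) (f : R * R -> R * R) u v : 0 <= c ->
  ((f u).1 - (f v).1) ^+ 2 + ((f u).2 - (f v).2) ^+ 2 =
    c ^+ 2 * ((u.1 - v.1) ^+ 2 + (u.2 - v.2) ^+ 2) ->
  euclidean_dist (f u) (f v) = c * euclidean_dist u v.
Proof.
by move=> c0 e; rewrite /euclidean_dist e sqrtrM ?sqr_ge0// sqrtr_sqr ger0_norm.
Qed.

Lemma dist_snowflake_f1 u v :
  euclidean_dist (snowflake_f1 u) (snowflake_f1 v) = euclidean_dist u v.
Proof.
rewrite -[RHS]mul1r; apply: euclidean_dist_scale => //.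
have : Num.sqrt 3 ^+ 2 = 3 :> R by rewrite sqr_sqrtr.
rewrite /snowflake_f1 /=; set t := Num.sqrt 3 => e.
transitivity (((u.1 - v.1) ^+ 2 + (u.2 - v.2) ^+ 2) * (1 + t ^+ 2) / 4).
  by field.
by rewrite e; field.
Qed.

Lemma dist_snowflake_f2 u v :
  euclidean_dist (snowflake_f2 u) (snowflake_f2 v) = euclidean_dist u v.
Proof.
rewrite -[RHS]mul1r; apply: euclidean_dist_scale => //.
have : Num.sqrt 3 ^+ 2 = 3 :> R by rewrite sqr_sqrtr.
rewrite /snowflake_f2 /=; set t := Num.sqrt 3 => e.
transitivity (((u.1 - v.1) ^+ 2 + (u.2 - v.2) ^+ 2) * (1 + t ^+ 2) / 4).
  by field.
by rewrite e; field.
Qed.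

(** The topology of R * R comes from the sup norm, which the Euclidean distance
dominates and which dominates it up to a factor 2. *)
Lemma nonexpansive_continuous (f : R * R -> R * R) :
  (forall u v, euclidean_dist (f u) (f v) <= euclidean_dist u v) -> continuous f.
Proof.
move=> fle u; apply/cvgrPdist_le => e e0.
near=> v.
have uv : `|u - v| <= e / 2.
  near: v; apply: cvgr_dist_le; [exact: cvg_id|exact: divr_gt0].
have [uv1 uv2] : `|u.1 - v.1| <= e / 2 /\ `|u.2 - v.2| <= e / 2.
  by move: uv; rewrite prod_normE ge_max => /andP.
have d : euclidean_dist u v <= e.
  apply: le_trans (euclidean_dist_le u v) _.
  by rewrite [leRHS]splitr lerD.
rewrite prod_normE ge_max; apply/andP; split.
  by apply: le_trans (le_euclidean_dist1 (f u) (f v)) _; exact: le_trans d.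
by apply: le_trans (le_euclidean_dist2 (f u) (f v)) _; exact: le_trans d.
Unshelve. all: by end_near. Qed.

End EuclideanDistance.

(** * Hausdorff measure and dimension *)

Lemma nneseries_le_natmul (R : realType) (f : nat -> \bar R) (n : nat) (c : R) :
  (forall i, 0 <= f i)%E -> (forall i, (i < n)%N -> (f i <= c%:E)%E) ->
  (forall i, (n <= i)%N -> f i = 0%E) ->
  (\sum_(0 <= i <oo) f i <= (n%:R * c)%:E)%E.
Proof.
move=> f0 fc fn; rewrite (@nneseries_split _ _ 0 n)//.
rewrite [X in (_ + X)%E]eseries0; last by move=> i ni _; exact: fn.
rewrite adde0 add0n; apply: (@le_trans _ _ (\sum_(0 <= i < n) c%:E)%E).
  by rewrite !big_mkord; apply: lee_sum => i _; exact: fc.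
by rewrite sumEFin lee_fin big_mkord sumr_const mulr_natl card_ord.
Qed.

Lemma outer_measure_le_natmul (R : realType) (T : Type)
    (mu : {outer_measure set T -> \bar R}) (A : nat -> set T) (X : set T)
    (n : nat) (c : R) :
  (forall i, (i < n)%N -> (mu (A i) <= c%:E)%E) ->
  X `<=` [set x | exists2 i, (i < n)%N & A i x] ->
  (mu X <= (n%:R * c)%:E)%E.
Proof.
move=> Ac XA; pose B i := if (i < n)%N then A i else set0.
apply: (@le_trans _ _ (mu (\bigcup_i B i))).
  by apply: le_outer_measure => x /XA[i ni Aix]; exists i => //; rewrite /B ni.
apply: le_trans (outer_measure_sigma_subadditive mu B) _.
apply: nneseries_le_natmul => i; first exact: outer_measure_ge0.
- by rewrite /B => ni; rewrite ni; exact: Ac.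
- by rewrite /B leqNgt => /negbTE ->; exact: outer_measure0.
Qed.

Section HausdorffMeasure.
Variable R : realType.
Implicit Types (E U : set (R * R)) (s : R).

Lemma diam_ge0 U : U !=set0 -> (0 <= diam U)%E.
Proof.
move=> [u Uu]; apply: ereal_sup_ubound => /=.
by exists u => //; exists u => //; rewrite /euclidean_dist !subrr expr0n addr0 sqrtr0.
Qed.

Lemma diam_le U (r : R) : (forall u v, U u -> U v -> euclidean_dist u v <= r) ->
  (diam U <= r%:E)%E.
Proof. by move=> h; apply: ge_ereal_sup => _ [u Uu [v Uv <-]]; rewrite lee_fin h. Qed.

Lemma dist_le_diam U u v : U u -> U v -> ((euclidean_dist u v)%:E <= diam U)%E.
Proof. by move=> Uu Uv; apply: ereal_sup_ubound; exists u => //; exists v. Qed.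

Lemma hausdorff_gauge_ge0 s U : (0 <= hausdorff_gauge s U)%E.
Proof. by rewrite /hausdorff_gauge; case: ifP => // _; exact: poweR_ge0. Qed.

Lemma hausdorff_gauge0 s : hausdorff_gauge s set0 = 0%E.
Proof. by rewrite /hausdorff_gauge eqxx. Qed.

Lemma hausdorff_gauge_le s U (r : R) : 0 <= s -> 0 <= r -> (diam U <= r%:E)%E ->
  (hausdorff_gauge s U <= (r `^ s)%:E)%E.
Proof.
move=> s0 r0 Ur; rewrite /hausdorff_gauge; case: ifPn => [_|/set0P U0].
  by rewrite lee_fin powR_ge0.
rewrite -poweR_EFin; apply: gt0_ler_poweR => //.
  by rewrite in_itv /= diam_ge0// leey.
by rewrite in_itv /= lee_fin r0 leey.
Qed.

Lemma hausdorff_premeasure_ge0 s delta E : (0 <= hausdorff_premeasure s delta E)%E.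
Proof.
apply: le_ereal_inf_tmp => _ [U _ <-]; apply: nneseries_ge0 => i _ _.
exact: hausdorff_gauge_ge0.
Qed.

Lemma hausdorff_measure_ge0 s E : (0 <= hausdorff_measure s E)%E.
Proof.
apply: le_trans (hausdorff_premeasure_ge0 s 1 E) _.
by apply: ereal_sup_ubound; exists 1 => /=.
Qed.

Lemma hausdorff_measure_eq0 s E :
  (forall delta e, 0 < delta -> 0 < e -> exists2 U : nat -> set (R * R),
     E `<=` \bigcup_i U i /\ (forall i, (diam (U i) <= delta%:E)%E) &
     (\sum_(0 <= i <oo) hausdorff_gauge s (U i) <= e%:E)%E) ->
  hausdorff_measure s E = 0%E.
Proof.
move=> h; apply/eqP; rewrite eq_le; apply/andP; split.
  apply: ge_ereal_sup => _ [delta /= delta0 <-].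
  apply/lee_addgt0Pr => e e0; rewrite add0e.
  have [U UE Ue] := h _ _ delta0 e0; apply: le_trans Ue.
  by apply: ereal_inf_lbound; exists U.
exact: hausdorff_measure_ge0.
Qed.

Lemma hausdorff_measureS s (E F : set (R * R)) : E `<=` F ->
  (hausdorff_measure s E <= hausdorff_measure s F)%E.
Proof.
move=> EF; apply: ge_ereal_sup => _ [delta /= delta0 <-].
apply: (@le_trans _ _ (hausdorff_premeasure s delta F)).
  apply: ereal_inf_le_tmp => _ [U [FU Ud] <-]; exists U => //; split => //.
  exact: subset_trans FU.
by apply: ereal_sup_ubound; exists delta.
Qed.

(** The premeasure at scale 1 is already at least c, and the measure is a supremum
over all scales. *)
Lemma hausdorff_measure_gt0 s (c : R) E : 0 < c ->
  (forall U : nat -> set (R * R), E `<=` \bigcup_i U i ->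
     (forall i, (diam (U i) <= 1%:E)%E) ->
     (c%:E <= \sum_(0 <= i <oo) hausdorff_gauge s (U i))%E) ->
  (0 < hausdorff_measure s E)%E.
Proof.
move=> c0 h; apply: (@lt_le_trans _ _ c%:E); first by rewrite lte_fin.
apply: (@le_trans _ _ (hausdorff_premeasure s 1 E)); last first.
  by apply: ereal_sup_ubound; exists 1 => /=.
by apply: le_ereal_inf_tmp => _ [U [EU U1] <-]; exact: h.
Qed.

Lemma hausdorff_dimE (d : R) E : 0 <= d ->
  (forall s, d < s -> hausdorff_measure s E = 0%E) ->
  (forall s, 0 <= s -> s < d -> (0 < hausdorff_measure s E)%E) ->
  hausdorff_dim E = d%:E.
Proof.
move=> d0 hi lo; apply/eqP; rewrite eq_le; apply/andP; split.
  apply/lee_addgt0Pr => e e0; apply: ereal_inf_lbound; exists (d + e) => //=.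
  by split; [rewrite addr_ge0 ?(ltW e0)|apply: hi; rewrite ltrDl].
apply: le_ereal_inf_tmp => _ [s [s0 Hs] <-]; rewrite lee_fin leNgt.
by apply/negP => /(lo s s0); rewrite Hs ltxx.
Qed.

End HausdorffMeasure.

(** * Planar Lebesgue measure *)

Section PlanarMeasure.
Variable R : realType.
Notation mu := (@lebesgue_measure R \x @lebesgue_measure R)%E.

Lemma lebesgue_measure_box (a b c d : R) : a <= b -> c <= d ->
  mu (`[a, b]%classic `*` `[c, d]%classic) = ((b - a) * (d - c))%:E.
Proof.
move=> ab cd; rewrite product_measure1E//= !lebesgue_measure_itv/= !lte_fin.
have [ab'|ba] := ltP a b; last first.
  by rewrite mul0e (le_anti (introT andP (conj ab ba))) subrr mul0r.
have [cd'|dc] := ltP c d; last first.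
  by rewrite mule0 (le_anti (introT andP (conj cd dc))) subrr mulr0.
by rewrite !EFinN.
Qed.

Definition square (c : R * R) (r : R) : set (R * R) :=
  `[c.1 - r, c.1 + r]%classic `*` `[c.2 - r, c.2 + r]%classic.

Lemma measurable_square c r : measurable (square c r).
Proof. by apply: measurableX; exact: measurable_itv. Qed.

Lemma measure_square c r : 0 <= r -> mu (square c r) = ((2 * r) ^+ 2)%:E.
Proof.
by move=> r0; rewrite lebesgue_measure_box; [congr EFin; ring|lra|lra].
Qed.

(** Balls of the sup norm are squares, so a non-empty open set contains a square of
positive measure. *)
Lemma negligible_no_interior (N U : set (R * R)) :
  mu.-negligible N -> open U -> U !=set0 -> ~ (U `<=` N).
Proof.
move=> N0 oU [z Uz] UN; have [B [mB B0 NB]] := N0.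
have /nbhs_ballP[e /= e0 zU] : nbhs z U by exact: open_nbhs_nbhs.
have sq : square z (e / 2) `<=` B.
  move=> w [] /=; rewrite !in_itv /= => /andP[x1 x2] /andP[y1 y2].
  apply/NB/UN/zU; rewrite -ball_normE /= prod_normE gt_max /=.
  by apply/andP; split; rewrite ltr_norml; apply/andP; split; lra.
have := le_measure mu (mem_set (measurable_square z (e / 2))) (mem_set mB) sq.
have e20 : 0 <= e / 2 by rewrite divr_ge0// ltW.
rewrite [leLHS](measure_square z e20) [leRHS]B0 lee_fin leNgt => /negP; apply.
by rewrite exprn_gt0// mulr_gt0 ?divr_gt0.
Qed.

End PlanarMeasure.

(** * Convexity, limits and base 6 digits *)

Section Preliminaries.
Variable R : realType.

Lemma convex_set2P (K : set (R * R)) : @convex_set R (R^o * R^o)%type K ->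
  forall (l : R) u v, 0 <= l <= 1 -> K u -> K v ->
  K (l * u.1 + (1 - l) * v.1, l * u.2 + (1 - l) * v.2).
Proof.
move=> cK l u v /andP[l0 l1] /mem_set Ku /mem_set Kv.
by have /set_mem := cK u v (Itv01 l0 l1) Ku Kv.
Qed.

Lemma cvg_geometric_eventually_le (a r e : R) :
  0 <= r < 1 -> 0 < e -> \forall m \near \oo, a * r ^+ m <= e.
Proof.
move=> /andP[r0 r1] e0.
have h : a * r ^+ m @[m --> \oo] --> 0.
  rewrite -(mulr0 a); apply: cvgM; first exact: cvg_cst.
  by apply: cvg_expr; rewrite ger0_norm.
move/cvgrPdist_le: h => /(_ e e0); apply: filterS => m.
by rewrite sub0r normrN => /(le_trans (ler_norm _)).
Qed.

Lemma same_cell (a b : R) : 0 <= a -> 0 <= b ->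
  Num.truncn a = Num.truncn b -> `|a - b| < 1.
Proof.
move=> /truncn_itv /andP[a1 a2] /truncn_itv /andP[b1 b2] e.
move: a1 a2; rewrite e => a1 a2; rewrite -natr1 in a2 b2.
by rewrite ltr_norml; apply/andP; split; lra.
Qed.

(** The integer whose base 6 expansion consists of the first k digits of x, for x in
[0, 1). *)
Definition digits (x : R) (k : nat) : nat := Num.truncn (x * 6 ^+ k).

Lemma digitsS x k : 0 <= x -> (digits x k.+1 %/ 6)%N = digits x k.
Proof.
move=> x0; have xk k' : 0 <= x * 6 ^+ k' by rewrite mulr_ge0// exprn_ge0.
have /andP[t1 t2] := truncn_itv (xk k); rewrite -/(digits x k) in t1 t2.
have lo : (digits x k * 6 <= digits x k.+1)%N.
  by rewrite truncn_ge_nat// natrM exprSr mulrA ler_pM2r.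
have hi : (digits x k.+1 < (digits x k).+1 * 6)%N.
  by rewrite truncn_lt_nat// natrM exprSr mulrA ltr_pM2r.
by apply/eqP; rewrite eqn_leq leq_divRL// lo -ltnS ltn_divLR// hi.
Qed.

Lemma digits_lt x k : 0 <= x -> x < 1 -> (digits x k < 6 ^ k)%N.
Proof.
move=> x0 x1; rewrite truncn_lt_nat ?mulr_ge0 ?exprn_ge0// natrX.
by rewrite gtr_pMl// exprn_gt0.
Qed.

Notation lambda := ((@lebesgue_measure R)^*)%mu.

Lemma lambda_itv (a b : R) : a <= b -> lambda `[a, b[%classic = (b - a)%:E.
Proof.
move=> ab; transitivity (lebesgue_measure `[a, b[%classic).
  by apply: measurable_mu_extE; exact: measurable_itv.
rewrite lebesgue_measure_itv /= lte_fin; case: ltP => [_|ba]; first by rewrite EFinB.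
by rewrite (le_anti (introT andP (conj ab ba))) subrr.
Qed.

End Preliminaries.

(** * The six similarities and the rhombus *)

(** One representative for each of the six distinct maps. *)
Definition letter (n : nat) : 'I_4 * bool :=
  match n with
  | 0 => (inord 0, false)
  | 1 => (inord 1, false)
  | 2 => (inord 1, true)
  | 3 => (inord 2, false)
  | 4 => (inord 2, true)
  | _ => (inord 3, false)
  end%N.

Section KochCurves.
Variables (R : realType) (p : R).
Hypothesis hp : 1 / 4 < p <= 1 / 3.

Notation q := (Num.sqrt (4 * p - 1)).
Notation dim := (ln 6 / ln p^-1).
Notation lambda := ((@lebesgue_measure R)^*)%mu.
Notation mu := (@lebesgue_measure R \x @lebesgue_measure R)%E.
Implicit Types (w : nat -> 'I_4 * bool).

Lemma p_gt0 : 0 < p. Proof. by case/andP: hp => ? ?; lra. Qed.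

Lemma p_lt1 : p < 1. Proof. by case/andP: hp => ? ?; lra. Qed.

Lemma q_sqr : q ^+ 2 = 4 * p - 1.
Proof. by rewrite sqr_sqrtr//; case/andP: hp => ? ?; lra. Qed.

Lemma q_gt0 : 0 < q.
Proof. by rewrite sqrtr_gt0; case/andP: hp => ? ?; lra. Qed.

Lemma q_le1 : q <= 1.
Proof. by have := q_sqr; have := q_gt0; case/andP: hp => ? ?; nra. Qed.

#[local] Hint Resolve p_gt0 p_lt1 q_gt0 : core.

Lemma dist_phi a u v :
  euclidean_dist (phi p a u) (phi p a v) = p * euclidean_dist u v.
Proof.
apply: euclidean_dist_scale (ltW p_gt0) _.
have e := q_sqr; rewrite /phi; case: a => -[[|[|[|[|//]]]] i] [] /=.
all: try by field.
all: transitivity (((u.1 - v.1) ^+ 2 + (u.2 - v.2) ^+ 2)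
                   * ((1 - 2 * p) ^+ 2 + q ^+ 2) / 4); first by field.
all: by rewrite e; field.
Qed.

Lemma phi_letter n z : phi p (letter n) z =
  match n with
  | 0%N => (p * z.1 - (1 - p) / 2, p * z.2)
  | 1%N => (((1 - 2 * p) * z.1 - q * z.2) / 2 + (2 * p - 1) / 4,
                 (q * z.1 + (1 - 2 * p) * z.2) / 2 + q / 4)
  | 2%N => (((1 - 2 * p) * z.1 + q * z.2) / 2 + (2 * p - 1) / 4,
                (- q * z.1 + (1 - 2 * p) * z.2) / 2 - q / 4)
  | 3%N => (((1 - 2 * p) * z.1 + q * z.2) / 2 + (1 - 2 * p) / 4,
                 (- q * z.1 + (1 - 2 * p) * z.2) / 2 + q / 4)
  | 4%N => (((1 - 2 * p) * z.1 - q * z.2) / 2 + (1 - 2 * p) / 4,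
                (q * z.1 + (1 - 2 * p) * z.2) / 2 - q / 4)
  | _ => (p * z.1 + (1 - p) / 2, p * z.2)
  end.
Proof. by case: n => [|[|[|[|[|n]]]]]; rewrite /phi /= inordK. Qed.

(** The maps labelled (0, b) and (3, b) do not depend on b, so six letters suffice. *)
Lemma phi_letter_surj (a : 'I_4 * bool) :
  exists2 n, (n < 6)%N & phi p a = phi p (letter n).
Proof.
case: a => -[[|[|[|[|//]]]] i] b; last first.
- by exists 5%N => //; apply/funext => z; rewrite phi_letter /phi; case: b.
- by exists (3 + b)%N; [case: b|apply/funext => z; rewrite phi_letter /phi; case: b].
- by exists (1 + b)%N; [case: b|apply/funext => z; rewrite phi_letter /phi; case: b].
- by exists 0%N => //; apply/funext => z; rewrite phi_letter /phi; case: b.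
Qed.

(** A multiple of the distance to the boundary for points of the rhombus: the
minimum over the four edges of an affine function that vanishes on that edge
([depth_ge], [depth_le]). *)
Definition depth (z : R * R) : R := q / 2 - q * `|z.1| - `|z.2|.

Lemma depth_ge (d : R) z :
  (forall s t : bool, d <= q / 2 - q * ((-1) ^+ s * z.1) - (-1) ^+ t * z.2) ->
  d <= depth z.
Proof.
move=> h; rewrite /depth.
case: (ger0P z.1) => _; case: (ger0P z.2) => _.
- by have := h false false; rewrite !expr0 !mul1r.
- by have := h false true; rewrite expr0 expr1 mul1r mulN1r.
- by have := h true false; rewrite expr0 expr1 mul1r mulN1r.
- by have := h true true; rewrite !expr1 !mulN1r.
Qed.

Lemma depth_le z (s t : bool) :
  depth z <= q / 2 - q * ((-1) ^+ s * z.1) - (-1) ^+ t * z.2.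
Proof.
have h1 : (-1) ^+ s * z.1 <= `|z.1|.
  by rewrite -(normrMsign s) ler_norm.
have h2 : (-1) ^+ t * z.2 <= `|z.2|.
  by rewrite -(normrMsign t) ler_norm.
have := ler_wpM2l (ltW q_gt0) h1; rewrite /depth; lra.
Qed.

Lemma depth_origin : depth (0, 0) = q / 2.
Proof. by rewrite /depth normr0 mulr0 !subr0. Qed.

Lemma depth_ge0_bound z : 0 <= depth z -> `|z.1| <= 1 / 2 /\ `|z.2| <= 1 / 2.
Proof.
have [q0 q1] := (q_gt0, q_le1); rewrite /depth => z0; split.
  by rewrite -(ler_pM2l q0); move: z0; have := normr_ge0 z.2; lra.
by move: z0; have := mulr_ge0 (ltW q0) (normr_ge0 z.1); lra.
Qed.

Lemma half_width z (s : bool) : 0 <= depth z -> (-1) ^+ s * z.1 <= 1 / 2.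
Proof.
move=> /depth_ge0_bound[x1 _]; apply: le_trans x1.
by rewrite -(normrMsign s) ler_norm.
Qed.

(** The abscissa of the image under the maps of the middle letters, measured from
the vertical lines x = 0 and x = -1/2 + p or x = 1/2 - p, is half the right-hand
side.  The right-hand side exceeds the left one by at least
(1 - 2 p - q^2) (1/2 - |x|), and 1 - 2 p - q^2 = 2 - 6 p is nonnegative because
p <= 1/3. *)
Lemma depth_le_horizontal z (s t : bool) : 0 <= depth z ->
  q * depth z <= (1 - 2 * p) * (1 / 2 - (-1) ^+ s * z.1) + q * ((-1) ^+ t * z.2).
Proof.
move=> z0; have x1 := half_width s z0.
have := depth_le z s (~~ t); rewrite signrN mulNr.
move: x1; move: (_ * z.1) (_ * z.2) (depth z) => x y D x1 d.
have := ler_wpM2l (ltW q_gt0) d.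
have b0 : 0 <= 2 - 6 * p by move/andP: hp => [_ ?]; lra.
have := ler_wpM2l b0 x1.
have : q * q * x = (4 * p - 1) * x by rewrite -expr2 q_sqr.
have : q * q = 4 * p - 1 by rewrite -expr2 q_sqr.
lra.
Qed.

(** The right-hand side is twice the ordinate of the image under the maps of the
middle letters, up to sign. *)
Lemma depth_le_vertical z (s t : bool) : 0 <= depth z ->
  q / 3 * depth z <= q * (1 / 2 + (-1) ^+ s * z.1) + (1 - 2 * p) * ((-1) ^+ t * z.2).
Proof.
move=> z0; have x1 := half_width (~~ s) z0.
have a1 : 1 / 3 <= 1 - 2 * p by move/andP: hp => [_ ?]; lra.
have := depth_le z (~~ s) (~~ t); move: x1; rewrite !signrN !mulNr.
move: z0; move: (_ * z.1) (_ * z.2) (depth z) => x y D z0 x1 d.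
have a0 : 0 <= 1 - 2 * p by lra.
have := ler_wpM2l a0 d.
have := ler_wpM2l (mulr_ge0 (ltW p_gt0) (ltW q_gt0)) x1.
have : q / 3 * D <= (1 - 2 * p) * D by rewrite ler_wpM2r//; have := q_le1; lra.
lra.
Qed.

(** The regions containing the six image rhombi, shrunk by the margin c: the
vertical lines x = -1/2 + p, x = 0 and x = 1/2 - p separate letters with
different first coordinates, and the line y = 0 separates the two middle maps
with the same first coordinate. *)
Definition zone (n : nat) (c : R) (w : R * R) : bool :=
  match n with
  | 0%N => w.1 <= - (1 / 2) + p - c
  | 1%N => (- (1 / 2) + p + c <= w.1 <= - c) && (c <= w.2)
  | 2%N => (- (1 / 2) + p + c <= w.1 <= - c) && (w.2 <= - c)
  | 3%N => (c <= w.1 <= 1 / 2 - p - c) && (c <= w.2)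
  | 4%N => (c <= w.1 <= 1 / 2 - p - c) && (w.2 <= - c)
  | _ => 1 / 2 - p + c <= w.1
  end.

Lemma zone_phi_letter n z : 0 <= depth z ->
  zone n (q / 6 * depth z) (phi p (letter n) z).
Proof.
move=> z0; have qD : 0 <= q * depth z by rewrite mulr_ge0// ltW.
have k s t := depth_le_horizontal s t z0; have l s t := depth_le_vertical s t z0.
have h (s : bool) : q / 6 * depth z <= p * (1 / 2 - (-1) ^+ s * z.1).
  have := depth_le z s true; have := depth_le z s false; rewrite expr0 expr1.
  have := half_width s z0; move: (_ * z.1) => x x1 d1 d2.
  have d : depth z <= q * (1 / 2 - x) by lra.
  have : q * depth z <= depth z by rewrite ler_piMl// q_le1.
  have : q / 6 * (1 / 2 - x) <= p * (1 / 2 - x).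
    rewrite ler_wpM2r ?subr_ge0//.
    by have := q_le1; have [??] := andP hp; lra.
  lra.
rewrite /zone phi_letter; case: n => [|[|[|[|[|n]]]]] /=; rewrite -?andbA.
- by have := h false; rewrite expr0; lra.
- apply/and3P; split.
  + by have := k true true; rewrite !expr1; lra.
  + by have := k false false; rewrite !expr0; lra.
  + by have := l false false; rewrite !expr0; lra.
- apply/and3P; split.
  + by have := k true false; rewrite expr1 expr0; lra.
  + by have := k false true; rewrite expr0 expr1; lra.
  + by have := l false true; rewrite expr0 expr1; lra.
- apply/and3P; split.
  + by have := k true false; rewrite expr1 expr0; lra.
  + by have := k false true; rewrite expr0 expr1; lra.
  + by have := l true false; rewrite expr1 expr0; lra.
- apply/and3P; split.
  + by have := k true true; rewrite !expr1; lra.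
  + by have := k false false; rewrite !expr0; lra.
  + by have := l true true; rewrite !expr1; lra.
- by have := h true; rewrite expr1; lra.
Qed.

(** The image of V lies in V and the map multiplies distances by p, so the image of a
point is at least p times as deep in V as the point. *)
Lemma depth_phi_letter n z : 0 <= depth z ->
  p * depth z <= depth (phi p (letter n) z).
Proof.
move=> z0; have := zone_phi_letter n z0.
have e : q * q = 4 * p - 1 by rewrite -expr2 q_sqr.
have d s t := ler_wpM2l (ltW p_gt0) (depth_le z s t).
have c0 : 0 <= q / 6 * depth z by rewrite mulr_ge0// divr_ge0// ltW.
have pq0 : 0 <= (1 - p) * q.
  by rewrite mulr_ge0 ?(ltW q_gt0)// subr_ge0 ltW// p_lt1.
rewrite phi_letter /zone.
have ex : q * q * z.1 = (4 * p - 1) * z.1 by rewrite e.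
have ey : q * q * z.2 = (4 * p - 1) * z.2 by rewrite e.
move: c0; move: (q / 6 * depth z) => c c0.
case: n => [|[|[|[|[|n]]]]] /=; rewrite -?andbA.
- by move=> w; apply: depth_ge => s t; have := d s t;
    case: s t => -[]; rewrite ?expr0 ?expr1 /=; lra.
(* The image of V under the map 1 has one edge along an edge of V: for that edge
   the affine function pulls back to p times an edge function.  The sign of the
   coordinates of the image, known from its zone, handles the other edges.  The
   next three maps are mirror images of this one. *)
- case/and3P => w1 w2 w3; apply: depth_ge => s t; have := d false false.
  have : 0 <= q * - (((1 - 2 * p) * z.1 - q * z.2) / 2 + (2 * p - 1) / 4).
    by rewrite mulr_ge0 ?(ltW q_gt0)//; lra.
  by case: s t => -[]; rewrite ?expr0 ?expr1 /=; lra.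
- case/and3P => w1 w2 w3; apply: depth_ge => s t; have := d false true.
  have : 0 <= q * - (((1 - 2 * p) * z.1 + q * z.2) / 2 + (2 * p - 1) / 4).
    by rewrite mulr_ge0 ?(ltW q_gt0)//; lra.
  by case: s t => -[]; rewrite ?expr0 ?expr1 /=; lra.
- case/and3P => w1 w2 w3; apply: depth_ge => s t; have := d true false.
  have : 0 <= q * (((1 - 2 * p) * z.1 + q * z.2) / 2 + (1 - 2 * p) / 4).
    by rewrite mulr_ge0 ?(ltW q_gt0)//; lra.
  by case: s t => -[]; rewrite ?expr0 ?expr1 /=; lra.
- case/and3P => w1 w2 w3; apply: depth_ge => s t; have := d true true.
  have : 0 <= q * (((1 - 2 * p) * z.1 - q * z.2) / 2 + (1 - 2 * p) / 4).
    by rewrite mulr_ge0 ?(ltW q_gt0)//; lra.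
  by case: s t => -[]; rewrite ?expr0 ?expr1 /=; lra.
- by move=> w; apply: depth_ge => s t; have := d s t;
    case: s t => -[]; rewrite ?expr0 ?expr1 /=; lra.
Qed.

Lemma depth_ge0_phi_letter n z : 0 <= depth z -> 0 <= depth (phi p (letter n) z).
Proof.
move=> z0; apply: le_trans (depth_phi_letter n z0).
by rewrite mulr_ge0// ltW// p_gt0.
Qed.

(** The zones of two distinct letters are separated by a horizontal or a vertical
line, and the image of z keeps a margin from that line. *)
Lemma letters_separated a b z z' : (a < 6)%N -> (b < 6)%N -> a != b ->
  0 <= depth z -> 0 <= depth z' ->
  q / 6 * depth z <= euclidean_dist (phi p (letter a) z) (phi p (letter b) z').
Proof.
move=> a6 b6 ab z0 z'0.
have c0 : 0 <= q / 6 * depth z by rewrite mulr_ge0// divr_ge0// ltW.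
have c'0 : 0 <= q / 6 * depth z' by rewrite mulr_ge0// divr_ge0// ltW.
have := zone_phi_letter a z0; have := zone_phi_letter b z'0.
move: c0 c'0; move: (_ * depth z) (_ * depth z') => c c'.
move: (phi _ _ z) (phi _ _ z') => w w' c0 c'0.
have := le_euclidean_dist1 w w'; have := le_euclidean_dist2 w w'.
rewrite !ler_norml; move: (euclidean_dist _ _) => d /andP[y1 y2] /andP[x1 x2].
have [_ p3] := andP hp; have p0 := p_gt0.
case: b b6 ab => [|[|[|[|[|[|//]]]]]] _; case: a a6 => [|[|[|[|[|[|//]]]]]] _ //= _;
  rewrite -?andbA.
all: repeat (case/and3P => ? ? ?) || move=> ?.
all: lra.
Qed.

(** * The rhombus as a compact set *)

Lemma depth_continuous : continuous depth.
Proof.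
move=> z; rewrite /depth.
apply: (@cvgB _ R^o); last by apply: cvg_norm; exact: cvg_snd.
apply: cvgB; [exact: cvg_cst|apply: cvgM; first exact: cvg_cst].
by apply: cvg_norm; exact: cvg_fst.
Qed.

Lemma closed_depth_ge0 : closed [set z | 0 <= depth z].
Proof.
by apply: (preimage_closed _ (@closed_ge R 0)) => z _; exact: depth_continuous.
Qed.

Lemma rhombusE : rhombus p = [set z | 0 <= depth z].
Proof.
have q0 := q_gt0; apply/seteqP; split => [z|z /= z0 K [_ /convex_set2P cK VK]].
  apply; split; first exact: closed_depth_ge0.
  - move=> u v l /set_mem /= u0 /set_mem /= v0; apply/mem_set => /=.
    apply: depth_ge => s t.
    have key (r a b x y x' y' : R) : 0 <= r <= 1 ->
        0 <= q / 2 - q * (a * x) - b * y -> 0 <= q / 2 - q * (a * x') - b * y' ->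
        0 <= q / 2 - q * (a * (r * x + (1 - r) * x')) - b * (r * y + (1 - r) * y').
      move=> /andP[r0 r1] /(ler_wpM2l r0) h.
      by move=> /(ler_wpM2l (_ : 0 <= 1 - r)); rewrite subr_ge0 => /(_ r1); lra.
    apply: key; first by apply/andP.
    + exact: le_trans u0 (depth_le u s t).
    + exact: le_trans v0 (depth_le v s t).
  - have n1 : `|1 / 2 : R| = 1 / 2 by rewrite ger0_norm.
    have n2 : `|q / 2| = q / 2 by rewrite ger0_norm// divr_ge0// ltW.
    by move=> w [[[->|->]|->]|->]; rewrite /depth /= ?normrN ?normr0 ?n1 ?n2; lra.
case: z z0 => x y z0.
have y1 : `|y| <= q / 2.
  by have := normr_ge0 x; move: z0; rewrite /depth /=; nra.
(* The point (x, y) lies on the horizontal chord from (- w, y) to (w, y), and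
   the ends of this chord divide two edges of the rhombus with ratio b. *)
pose b := `|y| * 2 / q; pose w := (1 - b) / 2.
have b01 : 0 <= b <= 1.
  by rewrite divr_ge0 ?mulr_ge0 ?(ltW q0)//= ler_pdivrMr// mul1r; lra.
have xw : `|x| <= w.
  rewrite -(ler_pM2l q0) (_ : q * w = q / 2 - `|y|).
    by move: z0; rewrite /depth /=; lra.
  by rewrite /w /b; field; rewrite gt_eqF.
pose y' : R := if 0 <= y then q / 2 else - (q / 2).
have Ky : K (0, y') by apply: VK; rewrite /y'; case: ifP; [left; right|right].
have yE : b * y' = y.
  rewrite /b /y'; case: ifPn => [h|]; first by rewrite ger0_norm//; field; rewrite gt_eqF.
  by rewrite -ltNge => h; rewrite ltr0_norm//; field; rewrite gt_eqF.
have K1 : K (w, y).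
  have := cK _ _ _ b01 Ky (VK (1 / 2, 0) _); rewrite /= mulr0 mulr0 add0r addr0 yE.
  by rewrite /w mulrA mulr1; apply; do 3 left.
have K2 : K (- w, y).
  have := cK _ _ _ b01 Ky (VK (- (1 / 2), 0) _); rewrite /= mulr0 mulr0 add0r addr0 yE.
  by rewrite mulrN mulrA mulr1; apply; do 2 left; right.
have [w0|w0] := eqVneq w 0.
  by move: xw K1; rewrite w0 normr_le0 => /eqP ->.
have w0' : 0 < w by rewrite lt_neqAle eq_sym w0 (le_trans _ xw).
move: xw; rewrite ler_norml => /andP[xw1 xw2].
have l01 : 0 <= (x + w) / (2 * w) <= 1.
  have w20 : 0 < 2 * w by rewrite mulr_gt0.
  by rewrite divr_ge0 ?ler_pdivrMr ?(ltW w20)//; lra.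
have := cK _ _ _ l01 K1 K2.
rewrite /= (_ : _ * w + _ = x); last by field.
by rewrite (_ : _ * y + _ = y)//; ring.
Qed.

Lemma rhombus_origin : rhombus p (0, 0).
Proof. by rewrite rhombusE/= depth_origin divr_ge0// ltW// q_gt0. Qed.

Lemma dist_rhombus u v : rhombus p u -> rhombus p v -> euclidean_dist u v <= 2.
Proof.
rewrite rhombusE => /depth_ge0_bound[u1 u2] /depth_ge0_bound[v1 v2].
apply: le_trans (euclidean_dist_le u v) _.
by have := ler_normB u.1 v.1; have := ler_normB u.2 v.2; lra.
Qed.

Lemma dist_origin z : rhombus p z -> euclidean_dist (0, 0) z <= 1.
Proof.
rewrite rhombusE => /depth_ge0_bound[x1 y1].
apply: le_trans (euclidean_dist_le _ _) _; rewrite /= !sub0r !normrN; lra.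
Qed.

Lemma compact_rhombus : compact (rhombus p).
Proof.
have box := compact_setX (@segment_compact R (- (1 / 2)) (1 / 2))
  (@segment_compact R (- (1 / 2)) (1 / 2)).
apply: (subclosed_compact _ box); rewrite rhombusE; first exact: closed_depth_ge0.
by move=> z /depth_ge0_bound[x1 y1]; split=> /=; rewrite in_itv /= -ler_norml.
Qed.

Lemma phi_rhombus a z : rhombus p z -> rhombus p (phi p a z).
Proof.
rewrite rhombusE/= => z0; have [n _ ->] := phi_letter_surj a.
exact: depth_ge0_phi_letter.
Qed.

(** * Tiles and addresses *)

(** The composition of m maps whose letters are the base 6 digits of j, the most
significant digit being the outermost map. *)
Fixpoint tile (m j : nat) : R * R -> R * R :=
  if m is m'.+1 then tile m' (j %/ 6) \o phi p (letter (j %% 6)) else id.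

Lemma dist_tile m j u v :
  euclidean_dist (tile m j u) (tile m j v) = p ^+ m * euclidean_dist u v.
Proof.
elim: m j u v => [|m IH] j u v /=; first by rewrite expr0 mul1r.
by rewrite IH dist_phi// mulrA exprSr.
Qed.

(** Induction on the level.  If the last digits alone differ, the points are images
under one tile map of points in two distinct first-level tiles.  Otherwise the
induction hypothesis applies to the images under the innermost maps, which keep
at least p times the depth. *)
Lemma tile_separated m j j' z z' : (j < 6 ^ m)%N -> (j' < 6 ^ m)%N -> j != j' ->
  0 <= depth z -> 0 <= depth z' ->
  p ^+ m * (q / 6 * depth z) <= euclidean_dist (tile m j z) (tile m j' z').
Proof.
have [p0 q0] := (p_gt0, q_gt0).
elim: m j j' z z' => [|m IH] j j' z z'.
  by rewrite expn0; case: j => //; case: j'.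
rewrite expnSr => jm j'm jj' z0 z'0 /=.
have [e|ne] := eqVneq (j %/ 6)%N (j' %/ 6)%N.
  rewrite e dist_tile exprSr -mulrA ler_pM2l ?exprn_gt0//.
  apply: le_trans (_ : q / 6 * depth z <= _); last first.
    apply: letters_separated; rewrite ?ltn_pmod//.
    by apply: contra_neq jj' => e'; rewrite (divn_eq j 6) (divn_eq j' 6) e e'.
  by rewrite ler_piMl ?mulr_ge0 ?divr_ge0 ?(ltW q_gt0)// ltW// p_lt1.
apply: le_trans (IH _ _ _ _ _ _ ne (depth_ge0_phi_letter _ z0)
  (depth_ge0_phi_letter _ z'0)).
- rewrite exprSr -mulrA ler_pM2l ?exprn_gt0// mulrCA.
  by rewrite ler_pM2l ?divr_gt0// depth_phi_letter.
- by rewrite ltn_divLR.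
- by rewrite ltn_divLR.
Qed.

Lemma phi_comp_subset w k i :
  phi_comp p w (k + i) @` rhombus p `<=` phi_comp p w k @` rhombus p.
Proof.
elim: i => [|i IH]; first by rewrite addn0.
rewrite addnS => _ [z Vz <-] /=; apply: IH.
by exists (phi p (w (k + i)%N) z) => //; exact: phi_rhombus.
Qed.

Lemma dist_phi_comp w k u v :
  euclidean_dist (phi_comp p w k u) (phi_comp p w k v)
  = p ^+ k * euclidean_dist u v.
Proof.
elim: k u v => [|k IH] u v /=; first by rewrite expr0 mul1r.
by rewrite IH dist_phi// mulrA exprSr.
Qed.

Lemma closed_phi_comp w k : closed (phi_comp p w k @` rhombus p).
Proof.
apply: compact_closed; first exact: norm_hausdorff.
apply: continuous_compact; last exact: compact_rhombus.
apply: continuous_subspaceT; apply: nonexpansive_continuous => u v.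
have [p0 p1] := (p_gt0, p_lt1).
by rewrite dist_phi_comp ler_piMl ?euclidean_dist_ge0// exprn_ile1// ltW.
Qed.

(** A cluster point of the images of the origin, which stay in the compact rhombus,
lies in every set of the nested sequence since these sets are closed. *)
Lemma bigcap_phi_comp_neq0 w : \bigcap_k (phi_comp p w k @` rhombus p) !=set0.
Proof.
have V0 := rhombus_origin.
pose c k := phi_comp p w k (0, 0).
have cV k i : (k <= i)%N -> (phi_comp p w k @` rhombus p) (c i).
  by move=> /subnKC <-; apply: phi_comp_subset; exists (0, 0).
have [z [_ clz]] : rhombus p `&` cluster (c @ \oo) !=set0.
  apply: compact_rhombus; exists 0%N => // i _ /=.
  have [y Vy <- //] : (phi_comp p w 0 @` rhombus p) (c i) by exact: cV.
exists z => k _; rewrite [X in X z](closure_id _).1; last exact: closed_phi_comp.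
by move=> B zB; apply: clz zB; exists k => // i /= ki; exact: cV.
Qed.

(** A tree that is constant on each level prescribes the second coordinates of all
letters independently of the first coordinates. *)
Lemma Sigma_exists w : exists s, Sigma s w.
Proof.
exists (fun k => [ffun=> (w k).2]), (fun k => (w k).1) => //.
by apply/funext => k; rewrite /omega ffunE; case: (w k).
Qed.

Lemma phi_comp_tile w k : exists2 j, (j < 6 ^ k)%N & phi_comp p w k = tile k j.
Proof.
elim: k => [|k [j jk e]]; first by exists 0%N.
have [n n6 e'] := phi_letter_surj (w k).
exists (j * 6 + n)%N; last by rewrite /= e e' divnMDl// divn_small// addn0 modnMDl modn_small.
by rewrite expnSr; lia.
Qed.

Lemma koch_curves_tile z m : all_koch_curves p z ->
  exists2 j, (j < 6 ^ m)%N & (tile m j @` rhombus p) z.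
Proof.
move=> [s _ [w _ /(_ m I) zm]]; have [j jm e] := phi_comp_tile w m.
by exists j => //; rewrite -e; apply: (@phi_comp_subset w m 1); rewrite addn1.
Qed.

(** A compatible sequence of tile indices, that is the truncations of a base 6
expansion, is the address of a point of some Koch curve. *)
Lemma coding_point (N : nat -> nat) : (forall k, N k.+1 %/ 6 = N k)%N ->
  exists2 z, all_koch_curves p z & forall m, (tile m (N m) @` rhombus p) z.
Proof.
move=> NE; pose w k := letter (N k.+1 %% 6).
have wN k : phi_comp p w k = tile k (N k).
  by elim: k => //= k ->; rewrite NE.
have [z zw] := bigcap_phi_comp_neq0 w; have [s sw] := Sigma_exists w.
exists z; last by move=> m; rewrite -wN; exact: zw.
by exists s => //; exists w => // k _; exact: zw.
Qed.

(** * The similarity dimension *)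

Lemma ln_pV_gt0 : 0 < ln p^-1.
Proof. by rewrite ln_gt0// invf_gt1 ?p_lt1. Qed.

Lemma dim_gt0 : 0 < dim.
Proof. by rewrite divr_gt0 ?ln_pV_gt0 ?ln_gt0 ?ltr1n. Qed.

Lemma dim_lt2 : dim < 2.
Proof.
rewrite ltr_pdivrMr ?ln_pV_gt0// mulr_natl -lnXn ?invr_gt0//.
rewrite ltr_ln ?posrE ?exprn_gt0 ?invr_gt0//.
have p3 : 3 <= p^-1 by rewrite -[3]invrK lef_pV2 ?posrE ?invr_gt0// -div1r; have [] := andP hp.
by rewrite expr2; nra.
Qed.

Lemma powR_dim : p `^ dim = 6^-1.
Proof.
have lnp : ln p = - ln p^-1 by rewrite lnV ?opprK.
rewrite /powR gt_eqF// lnp mulrN divfK ?gt_eqF ?ln_pV_gt0//.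
by rewrite expRN lnK ?posrE.
Qed.

Lemma powR_lt_inv6 s : dim < s -> p `^ s < 6^-1.
Proof.
move=> ds; rewrite -powR_dim /powR gt_eqF// ltr_expR ltr_nM2r//.
by rewrite ln_lt0// p_gt0 p_lt1.
Qed.

Lemma inv6X_le_powR s m : s <= dim -> 6^-1 ^+ m <= (p ^+ m) `^ s.
Proof.
move=> sd; rewrite -powR_dim -[X in _ <= X `^ _]powR_mulrn ?(ltW p_gt0)//.
rewrite powRAC powR_mulrn ?powR_ge0//.
apply: lerXn2r; rewrite ?nnegrE ?powR_ge0//.
rewrite /powR gt_eqF// ler_expR ler_wnM2r//.
by rewrite ltW// ln_lt0// p_gt0 p_lt1.
Qed.

(** * Covers of the snowflakes *)

Definition side (k : nat) : R * R -> R * R :=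
  match k with 0%N => id | 1%N => @snowflake_f1 R | _ => @snowflake_f2 R end.

Lemma dist_side k u v :
  euclidean_dist (side k u) (side k v) = euclidean_dist u v.
Proof. by case: k => [|[|k]] //=; rewrite ?dist_snowflake_f1 ?dist_snowflake_f2. Qed.

(** The index i encodes one of the three sides and one of the 6^m tiles; the empty
set beyond these makes a cover indexed by all natural numbers. *)
Definition snow_tile (m i : nat) : set (R * R) :=
  if (i < 3 * 6 ^ m)%N
  then (side (i %/ 6 ^ m) \o tile m (i %% 6 ^ m)) @` rhombus p else set0.

Lemma snow_tile_cover m :
  all_koch_snowflakes p `<=` [set z | exists2 i, (i < 3 * 6 ^ m)%N & snow_tile m i z].
Proof.
have sub k s z : (k < 3)%N -> koch_curve p s z ->
    exists2 i, (i < 3 * 6 ^ m)%N & snow_tile m i (side k z).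
  move=> k3 sz; have [|j jm [y Vy <-]] := @koch_curves_tile z m; first by exists s.
  have lt : (k * 6 ^ m + j < 3 * 6 ^ m)%N.
    by apply: leq_trans (leq_mul k3 (leqnn _)); rewrite mulSn addnC ltn_add2r.
  exists (k * 6 ^ m + j)%N => //; rewrite /snow_tile lt; exists y => //=.
  by rewrite divnMDl ?expn_gt0// divn_small// addn0 modnMDl modn_small.
move=> z [s [t [r [[sz|[y ty <-]]|[y ry <-]]]]].
- exact: (sub 0%N s z).
- exact: (sub 1%N t y).
- exact: (sub 2%N r y).
Qed.

Lemma dist_snow_tile m i u v : snow_tile m i u -> snow_tile m i v ->
  euclidean_dist u v <= 2 * p ^+ m.
Proof.
rewrite /snow_tile; case: ifP => // _ [u' Vu <-] [v' Vv <-] /=.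
rewrite dist_side dist_tile// mulrC ler_pM2r ?exprn_gt0//.
exact: dist_rhombus.
Qed.

Lemma hausdorff_measure_snowflakes s : ln 6 / ln p^-1 < s ->
  hausdorff_measure s (all_koch_snowflakes p) = 0%E.
Proof.
move=> ds; have s0 : 0 < s by apply: lt_trans ds; exact: dim_gt0.
apply: hausdorff_measure_eq0 => delta e delta0 e0.
have rlt : 0 <= 6 * p `^ s < 1.
  rewrite mulr_ge0 ?powR_ge0//=.
  by have := powR_lt_inv6 ds; rewrite -(ltr_pM2l (_ : 0 < 6))// divff.
have prange : 0 <= p < 1 by rewrite p_lt1 ltW.
have : \forall m \near \oo, 2 * p ^+ m <= delta /\
    3 * 2 `^ s * (6 * p `^ s) ^+ m <= e.
  by apply: filterI; exact: cvg_geometric_eventually_le.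
move=> [m _ /(_ m (leqnn m)) [md me]].
exists (snow_tile m).
  split=> [z /snow_tile_cover -/(_ m) [i _ zi]|i]; first by exists i.
  apply: diam_le => u v ui vi; exact: le_trans (dist_snow_tile ui vi) md.
have r0 : 0 <= 2 * p ^+ m by rewrite mulr_ge0// exprn_ge0// ltW.
apply: (@le_trans _ _ ((3 * 6 ^ m)%:R * (2 * p ^+ m) `^ s)%:E).
  apply: nneseries_le_natmul => i; first exact: hausdorff_gauge_ge0.
  - move=> im; apply: hausdorff_gauge_le => //; first exact: ltW.
    by apply: diam_le => u v; exact: dist_snow_tile.
  - by rewrite leqNgt /snow_tile => /negbTE ->; exact: hausdorff_gauge0.
rewrite lee_fin; apply: le_trans me.
rewrite powRM ?exprn_ge0 ?(ltW p_gt0)// -[p ^+ m]powR_mulrn ?(ltW p_gt0)//.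
rewrite powRAC powR_mulrn ?powR_ge0// natrM natrX exprMn.
by rewrite le_eqVlt; apply/orP; left; apply/eqP; ring.
Qed.

Lemma negligible_snowflakes : mu.-negligible (all_koch_snowflakes p).
Proof.
have V0 := rhombus_origin.
pose c m i := side (i %/ 6 ^ m) (tile m (i %% 6 ^ m) (0, 0)).
pose r m : R := 2 * p ^+ m.
have r0 m : 0 <= r m by rewrite mulr_ge0// exprn_ge0// ltW.
pose B m : set (R * R) := \bigcup_(i < 3 * 6 ^ m) square (c m i) (r m).
have mB m : measurable (B m).
  by apply: bigcup_measurable => i _; exact: measurable_square.
(* There are 3 * 6^m squares of side 4 p^m, and 48 = 3 * 16. *)
have muB m : (mu (B m) <= (48 * (6 * p ^+ 2) ^+ m)%:E)%E.
  rewrite -(measurable_mu_extE mu (mB m)).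
  apply: (@le_trans _ _ ((3 * 6 ^ m)%:R * (2 * r m) ^+ 2)%:E).
    apply: outer_measure_le_natmul => [i _|z [i]]; last first.
      exact: (fun im zi => ex_intro2 _ _ i im zi).
    have e := measurable_mu_extE mu (measurable_square (c m i) (r m)).
    by rewrite [leLHS](etrans e (measure_square _ (r0 m))).
  rewrite lee_fin le_eqVlt; apply/orP; left; apply/eqP.
  have pE : (p ^+ 2) ^+ m = (p ^+ m) ^+ 2 by rewrite -!exprM mulnC.
  by rewrite natrM natrX [(6 * _) ^+ m]exprMn pE /r; ring.
exists (\bigcap_m B m); split.
- by apply: bigcapT_measurable.
- apply/eqP; rewrite eq_le measure_ge0 andbT; apply/lee_addgt0Pr => e e0.
  have rlt : 0 <= 6 * p ^+ 2 < 1.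
    have [_ p3] := andP hp; rewrite mulr_ge0 ?sqr_ge0//=.
    by rewrite expr2; have := p_gt0; nra.
  have [m _ /(_ m (leqnn m)) me] := cvg_geometric_eventually_le 48 rlt e0.
  rewrite add0e; apply: le_trans (_ : (48 * (6 * p ^+ 2) ^+ m)%:E <= _)%E;
    last by rewrite lee_fin.
  apply: le_trans (muB m).
  have mN := bigcapT_measurable mB.
  exact: (le_measure mu (mem_set mN) (mem_set (mB m)) (fun z Nz => Nz m I)).
- move=> z /(snow_tile_cover) zc m _; have [i im zi] := zc m.
  exists i => //; have ci : snow_tile m i (c m i).
    by rewrite /snow_tile im; exists (0, 0).
  have zc' := dist_snow_tile zi ci.
  have := le_trans (le_euclidean_dist1 _ _) zc'.
  have := le_trans (le_euclidean_dist2 _ _) zc'.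
  rewrite !ler_norml /square /r /= !in_itv /= => /andP[h1 h2] /andP[h3 h4].
  by split; apply/andP; split; lra.
Qed.

(** * The number of tiles that meet a small set *)

(** Distinct tiles of level m have centres at distance at least gap * p^m, by
[tile_separated]. *)
Let gap : R := q / 6 * depth (0, 0).

Lemma gap_gt0 : 0 < gap.
Proof. by rewrite /gap depth_origin mulr_gt0 ?divr_gt0 ?q_gt0. Qed.

(** The centres of the tiles that meet a given set of diameter p^m lie in a square
of side 6 p^m; this many cells of side gap * p^m / 2 cover one side of that
square. *)
Definition grid_size : nat := (Num.truncn (12 / gap)).+1.

Definition meets (m : nat) (U : set (R * R)) : {pred 'I_(6 ^ m)} :=
  fun j => `[< exists2 z, U z & (tile m j @` rhombus p) z >].
Arguments meets : clear implicits.

(** The cells are so small that two distinct centres, which are at distance at least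
gap * p^m, never share one: mapping a tile to the cell of its centre is
injective. *)
Lemma card_meets m (U : set (R * R)) :
  (forall u v, U u -> U v -> euclidean_dist u v <= p ^+ m) ->
  (#|meets m U| <= grid_size * grid_size)%N.
Proof.
move=> Um; case: (pickP (meets m U)) => [j0 j0J|]; last by move/eq_card0 ->.
have pm0 : 0 < p ^+ m by rewrite exprn_gt0.
have V0 := rhombus_origin.
pose c (j : 'I_(6 ^ m)) : R * R := tile m j (0, 0).
have near_c j : j \in meets m U ->
    `|(c j).1 - (c j0).1| <= 3 * p ^+ m /\ `|(c j).2 - (c j0).2| <= 3 * p ^+ m.
  have near_U i : i \in meets m U -> exists2 u, U u & euclidean_dist (c i) u <= p ^+ m.
    move=> /asboolP[u Uu [y Vy yu]]; exists u => //.
    by rewrite -yu dist_tile// ler_piMr ?(ltW pm0)// dist_origin.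
  move=> /near_U[u Uu cu]; have [u0 Uu0 cu0] := near_U j0 j0J.
  have uu0 := Um _ _ Uu Uu0.
  have := le_trans (le_euclidean_dist1 _ _) cu.
  have := le_trans (le_euclidean_dist2 _ _) cu.
  have := le_trans (le_euclidean_dist1 _ _) cu0.
  have := le_trans (le_euclidean_dist2 _ _) cu0.
  have := le_trans (le_euclidean_dist1 _ _) uu0.
  have := le_trans (le_euclidean_dist2 _ _) uu0.
  move: (p ^+ m) (c j) (c j0) => P a b; rewrite !ler_norml.
  by do 6 move=> /andP[? ?]; split; apply/andP; split; lra.
pose h : R := gap * p ^+ m / 2.
have h0 : 0 < h by rewrite divr_gt0// mulr_gt0// gap_gt0.
pose cell (t : R) : R := (t + 3 * p ^+ m) / h.
have cell_itv t : `|t| <= 3 * p ^+ m -> 0 <= cell t <= 12 / gap.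
  rewrite ler_norml => /andP[t1 t2]; rewrite /cell divr_ge0 ?(ltW h0)//=; last lra.
  rewrite ler_pdivrMr// (_ : _ * h = 6 * p ^+ m); first lra.
  by rewrite /h; field; rewrite gt_eqF// gap_gt0.
pose f j : 'I_grid_size * 'I_grid_size :=
  (inord (Num.truncn (cell ((c j).1 - (c j0).1))),
   inord (Num.truncn (cell ((c j).2 - (c j0).2)))).
have same t t' : `|t| <= 3 * p ^+ m -> `|t'| <= 3 * p ^+ m ->
    inord (Num.truncn (cell t)) = inord (Num.truncn (cell t')) :> 'I_grid_size ->
    `|t - t'| < h.
  move=> /cell_itv /andP[t0 t1] /cell_itv /andP[t'0 t'1] /(congr1 (@nat_of_ord _)).
  rewrite !inordK ?ltnS ?le_truncn// => /(same_cell t0 t'0).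
  rewrite (_ : cell t - cell t' = (t - t') / h); last by rewrite /cell; field; rewrite gt_eqF.
  by rewrite normrM normfV (gtr0_norm h0) ltr_pdivrMr// mul1r.
have inj : {in meets m U &, injective f}.
  move=> j j' jJ j'J [e1 e2]; apply/eqP/negP => /negP jj'.
  have [j1 j2] := near_c j jJ; have [j'1 j'2] := near_c j' j'J.
  have {e1} d1 := same _ _ j1 j'1 e1; have {e2} d2 := same _ _ j2 j'2 e2.
  have V00 : 0 <= depth (0, 0) by move: V0; rewrite rhombusE.
  have := tile_separated (ltn_ord j) (ltn_ord j') jj' V00 V00.
  apply/negP; rewrite -ltNge; apply: le_lt_trans (euclidean_dist_le _ _) _.
  have shift (a b d : R) : a - d - (b - d) = a - b by ring.
  by move: d1 d2; rewrite !shift /h -/(c j) -/(c j') -/gap; lra.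
have := max_card (mem [seq f j | j in meets m U]).
by rewrite card_in_image// card_prod card_ord.
Qed.

(** * The mass distribution *)

(** The parameters x in [0, 1) for which some point with the base 6 address of x lies
in D and in U. *)
Definition pullback (U : set (R * R)) : set R :=
  [set x | 0 <= x < 1 /\ exists2 z, all_koch_curves p z /\ U z &
     forall m, (tile m (digits x m) @` rhombus p) z].

Lemma pullback0 : pullback set0 = set0.
Proof. by apply/seteqP; split => // x [_ [z []]]. Qed.

Lemma pullback_cover (U : nat -> set (R * R)) :
  all_koch_curves p `<=` \bigcup_i U i ->
  `[0, 1[%classic `<=` \bigcup_i pullback (U i).
Proof.
move=> DU x /=; rewrite in_itv /= => x01; have [x0 _] := andP x01.
have [z Dz zx] := coding_point (fun k => digitsS k x0).
by have [i _ Uiz] := DU z Dz; exists i => //; split => //; exists z.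
Qed.

Lemma lambda_pullback_le m (U : set (R * R)) :
  (forall u v, U u -> U v -> euclidean_dist u v <= p ^+ m) ->
  (lambda (pullback U) <= ((grid_size * grid_size)%:R * 6^-1 ^+ m)%:E)%E.
Proof.
move=> Um; have m0 : 0 < 6 ^+ m :> R by rewrite exprn_gt0.
pose A i : set R :=
  let j := nth 0%N [seq val j | j in meets m U] i in
  `[j%:R / 6 ^+ m, j.+1%:R / 6 ^+ m[%classic.
apply: (@le_trans _ _ (#|meets m U|%:R * 6^-1 ^+ m)%:E); last first.
  by rewrite lee_fin ler_pM2r ?exprn_gt0// ler_nat card_meets.
have := @outer_measure_le_natmul R _ lambda A (pullback U) #|meets m U| (6^-1 ^+ m).
apply => [i _|x [/andP[x0 x1] [z [Dz Uz] zx]]].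
  rewrite [leLHS]lambda_itv ?ler_pM2r ?invr_gt0 ?ler_nat// lee_fin.
  by rewrite -mulrBl -natrB// subSnn mul1r exprVn.
pose j := Ordinal (digits_lt m x0 x1).
have jU : j \in meets m U by apply/asboolP; exists z => //; exact: zx.
have jin : val j \in [seq val j | j in meets m U] by apply: map_f; rewrite mem_enum.
exists (index (val j) [seq val j | j in meets m U]).
  by rewrite -index_mem size_image in jin.
rewrite /A nth_index//= in_itv /= ler_pdivrMr// ltr_pdivlMr//.
by rewrite truncn_itv// mulr_ge0// ltW.
Qed.

(** For diam U = r > 0, the level m with p^(m+1) < r <= p^m gives the bound
M 6^-m <= M p^(m s) <= M p^(-s) r^s.  If r = 0 every level may be used. *)
Lemma lambda_pullback_gauge s (U : set (R * R)) : 0 <= s -> s < dim ->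
  (diam U <= 1%:E)%E ->
  (lambda (pullback U) <=
     ((grid_size * grid_size)%:R * p `^ (- s))%:E * hausdorff_gauge s U)%E.
Proof.
move=> s0 sd U1; have [->|U0] := eqVneq U set0.
  by rewrite pullback0 hausdorff_gauge0 mule0 outer_measure0.
have /set0P/diam_ge0 d0 := U0; rewrite /hausdorff_gauge (negbTE U0).
set M := (grid_size * grid_size)%N; have M0 : 0 < M%:R :> R by rewrite ltr0n muln_gt0.
have [r rE] : exists r, diam U = r%:E.
  by exists (fine (diam U)); rewrite fineK// ge0_fin_numE// (le_lt_trans U1)// ltry.
have dU u v : U u -> U v -> euclidean_dist u v <= r.
  by move=> Uu Uv; rewrite -lee_fin -rE dist_le_diam.
move: d0 U1; rewrite rE !lee_fin => r0 r1.
have [r_eq0|r_neq0] := eqVneq r 0.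
  have [s_eq0|s_neq0] := eqVneq s 0.
    rewrite s_eq0 oppr0 poweRe0 powRr0 mule1 mulr1.
    have := @lambda_pullback_le 0 U; rewrite !expr0 mulr1; apply => u v Uu Uv.
    exact: le_trans (dU _ _ Uu Uv) r1.
  rewrite r_eq0 poweR0r// mule0; apply/lee_addgt0Pr => e e0.
  have six : 0 <= (6^-1 : R) < 1 by apply/andP; split; lra.
  have [m _ /(_ m (leqnn m)) me] := cvg_geometric_eventually_le M%:R six e0.
  rewrite add0e; apply: (@le_trans _ _ (M%:R * 6^-1 ^+ m)%:E); last by rewrite lee_fin.
  apply: lambda_pullback_le => u v Uu Uv; apply: le_trans (dU _ _ Uu Uv) _.
  by rewrite r_eq0 exprn_ge0// ltW.
have rpos : 0 < r by rewrite lt_neqAle eq_sym r_neq0.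
have [m pm mp] : exists2 m, p ^+ m.+1 < r & r <= p ^+ m.
  have ex : exists m, p ^+ m < r.
    have pr : 0 <= p < 1 by rewrite p_lt1 ltW.
    have [m _ /(_ m (leqnn m)) me] := cvg_geometric_eventually_le 1 pr
      (divr_gt0 rpos (ltr0n _ 2)).
    by exists m; move: me; rewrite mul1r; lra.
  case: (ex_minnP ex) => -[|m] pm mmin.
    by move: pm; rewrite expr0 ltNge r1.
  by exists m => //; rewrite leNgt; apply/negP => /mmin; rewrite ltnn.
apply: le_trans (lambda_pullback_le (fun u v Uu Uv => le_trans (dU u v Uu Uv) mp)) _.
rewrite poweR_EFin -EFinM lee_fin -mulrA ler_pM2l//.
apply: le_trans (inv6X_le_powR m (ltW sd)) _.
have -> : p ^+ m = p^-1 * p ^+ m.+1 by rewrite exprS mulKf// gt_eqF.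
rewrite powRM ?invr_ge0 ?exprn_ge0 ?(ltW p_gt0)//.
have -> : p^-1 `^ s = p `^ (- s) by rewrite -(powR_inv1 (ltW p_gt0)) -powRrM mulN1r.
rewrite ler_pM2l ?powR_gt0//.
by apply: ge0_ler_powR => //; rewrite ?nnegrE ?exprn_ge0 ?(ltW p_gt0)// ltW.
Qed.

(** The outer measure of [0, 1) is 1, and it is at most the sum of those of the
pullbacks of the covering sets. *)
Lemma hausdorff_measure_curves_gt0 s : 0 <= s -> s < dim ->
  (0 < hausdorff_measure s (all_koch_curves p))%E.
Proof.
move=> s0 sd; set K := (grid_size * grid_size)%:R * p `^ (- s).
have K0 : 0 < K by rewrite mulr_gt0 ?powR_gt0// ltr0n muln_gt0.
apply: (@hausdorff_measure_gt0 _ _ K^-1); first by rewrite invr_gt0.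
move=> U DU U1.
have : (1%:E <= K%:E * \sum_(0 <= i <oo) hausdorff_gauge s (U i))%E.
  rewrite -nneseriesZl; last by move=> i _; exact: hausdorff_gauge_ge0.
  have -> : 1%:E = lambda `[0, 1[%classic by rewrite lambda_itv// subr0.
  apply: le_trans (le_outer_measure lambda _ _ (pullback_cover DU)) _.
  apply: le_trans (outer_measure_sigma_subadditive lambda _) _.
  apply: lee_nneseries => i *; first exact: outer_measure_ge0.
  exact: lambda_pullback_gauge.
by rewrite -lee_pdivrMl// mule1.
Qed.

Lemma koch_curves_sub_snowflakes : all_koch_curves p `<=` all_koch_snowflakes p.
Proof. by move=> z [s _ sz]; exists s, s, s; left; left. Qed.

(** Applied to the union of all curves and to the union of all snowflakes. *)
Lemma hausdorff_dim_between (E : set (R * R)) :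
  all_koch_curves p `<=` E -> E `<=` all_koch_snowflakes p ->
  hausdorff_dim E = dim%:E.
Proof.
move=> DE EF; apply: hausdorff_dimE; first exact: ltW dim_gt0.
- move=> s ds; apply/eqP; rewrite eq_le.
  rewrite -[X in (_ <= X)%E && _](hausdorff_measure_snowflakes ds).
  by rewrite hausdorff_measureS//= hausdorff_measure_ge0.
- move=> s s0 sd; apply: lt_le_trans (hausdorff_measureS s DE).
  exact: hausdorff_measure_curves_gt0.
Qed.

End KochCurves.

Unset Implicit Arguments.

Theorem mainTheorem4 (R : realType) (p : R) (hp : 1 / 4 < p <= 1 / 3) :
  [/\ hausdorff_dim (all_koch_snowflakes p) = hausdorff_dim (all_koch_curves p),
      hausdorff_dim (all_koch_curves p) = (ln 6 / ln p^-1)%:E,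
      ln 6 / ln p^-1 < 2,
      forall U : set (R * R),
        open U -> U !=set0 -> ~ (U `<=` all_koch_snowflakes p)
    & (lebesgue_measure \x lebesgue_measure)%E.-negligible
        (all_koch_snowflakes p)].
Proof.
have sub := @koch_curves_sub_snowflakes R p.
have null := negligible_snowflakes hp.
rewrite (hausdorff_dim_between hp sub (@subset_refl _ _)).
rewrite (hausdorff_dim_between hp (@subset_refl _ _) sub).
split=> //; first exact: dim_lt2.
by move=> U oU U0; exact: negligible_no_interior.
Qed.
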